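(* Let $F$ be an algebraically closed field of characteristic $0$, let $G$ be a finite additive abelian group, $\beta:G\times G\to F^\times$ an alternating bicharacter, and let $(G,\beta,R)$ be a skew root system of Lie type. Then $L(R)$ is a semisimple Lie algebra, and the $G$-grading $L(R)=\bigoplus_{a\in R}Fu_a$ is a multiplicity free semisimple grading.
   Context: An alternating bicharacter is a $\mathbb{Z}$-bilinear map $\beta:G\times G\to F^\times$ with $\beta(g,g)=1$ for all $g\in G$; $\mathrm{Rad}(\beta)=\{g\in G:\beta(g,h)=1\text{ for all }h\in G\}$. Skew root system of Lie type $(G,\beta,R)$: $\mathrm{Rad}(\beta)\neq G$ and $R\subseteq G$ satisfies: (SRSL0) $R\subseteq G\setminus\mathrm{Rad}(\beta)$ and $R$ generates $G$; (SRSL1) $a\in R$ implies $-a\in R$; (SRSL2) if $a,b\in R$ and $\beta(a,b)\neq 1$, then $a+b\in R$. The algebra $L(R)$: choose a 2-cocycle $\xi\in Z^2(G,F^\times)$ (trivial action) with $\xi(a,b)\xi(b,a)^{-1}=\beta(a,b)$ for all $a,b\in G$ (such $\xi$ exists, and different choices give isomorphic graded algebras). The twisted group algebra $F^\xi G$ is the associative algebra with basis $\{u_g:g\in G\}$ and product $u_au_b=\xi(a,b)u_{a+b}$. Then $L(R)=\bigoplus_{a\in R}Fu_a\subseteq F^\xi G$ with bracket $[x,y]=xy-yx$, graded with $L(R)_a=Fu_a$. A grading is multiplicity free if each homogeneous component (of degree in the support) is 1-dimensional. A grading on a Lie algebra is semisimple if each homogeneous element is semisimple (i.e. ad-semisimple).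 *)

(* Defs.v *)
From HB Require Import structures.
From mathcomp Require Import all_boot all_order all_fingroup all_algebra all_field.
From mathcomp Require Import ring.

Set Implicit Arguments.
Unset Strict Implicit.
Unset Printing Implicit Defensive.

Import GRing.Theory FinRing.Theory.
Local Open Scope ring_scope.

Section AlternatingBicharacter.
Variables (F : fieldType) (G : finZmodType) (beta : G -> G -> F).

(* Values in F^* are values in F together with the nonvanishing clause. *)
Definition alternating_bicharacter : Prop :=
  [/\ forall g h, beta g h != 0,
      forall g g' h, beta (g + g') h = beta g h * beta g' h,
      forall g h h', beta g (h + h') = beta g h * beta g h'
    & forall g, beta g g = 1].

Definition Rad : {set G} := [set g | [forall h, beta g h == 1]].

(* <<R>> is the subgroup of the additive group G generated by R. *)
Definition skew_root_system (R : {set G}) : Prop :=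
  Rad != [set: G] /\
  [/\ R \subset [set: G] :\: Rad,
      <<R>>%g = [set: G],
      forall a, a \in R -> - a \in R
    & forall a b, a \in R -> b \in R -> beta a b != 1 -> a + b \in R].

End AlternatingBicharacter.

Record cocycle2 (F : fieldType) (G : finZmodType) := Cocycle2 {
  cocycle_fun :> G -> G -> F;
  cocycle_neq0 : forall a b, cocycle_fun a b != 0;
  cocycleP : forall a b c,
    cocycle_fun a b * cocycle_fun (a + b) c
    = cocycle_fun b c * cocycle_fun a (b + c)
}.

(* The twisted group algebra: x : F^xi G stands for \sum_a (x a) u_a.  It is
   an alias, so that it does not inherit the pointwise product of ffuns. *)
Definition twisted_group_algebra (F : fieldType) (G : finZmodType)
  (xi : cocycle2 F G) : Type := {ffun G -> F^o}.

Section TwistedGroupAlgebra.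
Variables (F : fieldType) (G : finZmodType) (xi : cocycle2 F G).
Local Notation A := (twisted_group_algebra xi).

HB.instance Definition _ := Vector.copy A {ffun G -> F^o}.

Definition tga_basis (a : G) : A := [ffun g => (g == a)%:R].

(* Since xi is not assumed to be normalized, the unit need not be u_0. *)
Definition tga_one : A := (xi 0 0)^-1 *: tga_basis 0.

Definition tga_mul (x y : A) : A :=
  \sum_a \sum_b (x a * y b * xi a b) *: tga_basis (a + b).

Lemma tga_mulE x y g : tga_mul x y g = \sum_a x a * y (g - a) * xi a (g - a).
Proof.
rewrite /tga_mul sum_ffunE; apply: eq_bigr => a _; rewrite sum_ffunE.
rewrite (bigD1 (g - a)) //= big1 ?addr0 => [|b neq_b].
  by rewrite !ffunE [a + _]addrC subrK eqxx [LHS]mulr1.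
rewrite !ffunE; case: eqP => [def_g|_]; last exact: scaler0.
by rewrite def_g [a + b]addrC addrK eqxx in neq_b.
Qed.

Lemma cocycle0l a : xi 0 a = xi 0 0.
Proof.
have := cocycleP xi 0 0 a; rewrite !add0r.
by move/(mulIf (cocycle_neq0 xi 0 a))/esym.
Qed.

Lemma cocycle0r a : xi a 0 = xi 0 0.
Proof.
have := cocycleP xi a 0 0; rewrite !addr0.
by move/(mulIf (cocycle_neq0 xi a 0)).
Qed.

Lemma tga_mulA : associative tga_mul.
Proof.
move=> x y z; apply/ffunP => g; rewrite !tga_mulE.
under eq_bigr => a _.
  rewrite tga_mulE (reindex_inj (addIr (- a))) /= mulr_sumr mulr_suml; over.
rewrite exchange_big /=; apply: eq_bigr => c _.
rewrite tga_mulE !mulr_suml; apply: eq_bigr => a _.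
have -> : g - a - (c - a) = g - c by rewrite opprB addrA subrK.
have := cocycleP xi a (c - a) (g - c).
have -> : a + (c - a) = c by rewrite addrC subrK.
have -> : c - a + (g - c) = g - a by rewrite addrC addrA subrK.
move: (xi a (c - a)) (xi c (g - c)) (xi (c - a) (g - c)) (xi a (g - a)).
move: (x a : F) (y (c - a) : F) (z (g - c) : F) => p q r s t v w e.
have -> : p * q * s * r * t = p * q * r * (s * t) :> F by ring.
by rewrite e; ring.
Qed.

Lemma tga_mul1r : left_id tga_one tga_mul.
Proof.
move=> x; apply/ffunP => g; rewrite tga_mulE (bigD1 0) //= big1 ?addr0.
  rewrite !ffunE eqxx subr0 cocycle0l [_ *: _]mulr1.
  by rewrite mulrAC mulVf ?mul1r ?cocycle_neq0.
by move=> a /negPf nz_a; rewrite !ffunE nz_a scaler0 !mul0r.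
Qed.

Lemma tga_mulr1 : right_id tga_one tga_mul.
Proof.
move=> x; apply/ffunP => g; rewrite tga_mulE (bigD1 g) //= big1 ?addr0.
  rewrite !ffunE subrr eqxx cocycle0r [_ *: _]mulr1.
  by rewrite -mulrA mulVf ?mulr1 ?cocycle_neq0.
by move=> a nz_a; rewrite !ffunE subr_eq0 eq_sym (negPf nz_a) scaler0 mulr0 mul0r.
Qed.

Lemma tga_mulDl : left_distributive tga_mul +%R.
Proof.
move=> x y z; apply/ffunP => g; rewrite ffunE !tga_mulE -big_split /=.
by apply: eq_bigr => a _; rewrite ffunE !mulrDl.
Qed.

Lemma tga_mulDr : right_distributive tga_mul +%R.
Proof.
move=> x y z; apply/ffunP => g; rewrite ffunE !tga_mulE -big_split /=.
by apply: eq_bigr => a _; rewrite ffunE !(mulrDr, mulrDl).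
Qed.

Lemma tga_oner_neq0 : tga_one != 0.
Proof.
apply/eqP => /ffunP/(_ 0); rewrite !ffunE eqxx => /eqP.
by rewrite scaler_eq0 invr_eq0 oner_eq0 orbF (negPf (cocycle_neq0 xi 0 0)).
Qed.

HB.instance Definition _ := GRing.Zmodule_isNzRing.Build A
  tga_mulA tga_mul1r tga_mulr1 tga_mulDl tga_mulDr tga_oner_neq0.

Lemma tga_scalerAl (k : F) (x y : A) : k *: (x * y) = (k *: x) * y.
Proof.
apply/ffunP => g; rewrite ffunE !tga_mulE scaler_sumr.
apply: eq_bigr => a _; rewrite ffunE.
move: (x a : F) (y (g - a) : F) (xi a (g - a)) => p q r.
by rewrite -[LHS]/(k * (p * q * r)) -[k *: (p : F^o)]/(k * p); ring.
Qed.

HB.instance Definition _ := GRing.Lmodule_isLalgebra.Build F A tga_scalerAl.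

Lemma tga_scalerAr (k : F) (x y : A) : k *: (x * y) = x * (k *: y).
Proof.
apply/ffunP => g; rewrite ffunE !tga_mulE scaler_sumr.
apply: eq_bigr => a _; rewrite ffunE.
move: (x a : F) (y (g - a) : F) (xi a (g - a)) => p q r.
by rewrite -[LHS]/(k * (p * q * r)) -[k *: (q : F^o)]/(k * q); ring.
Qed.

HB.instance Definition _ := GRing.Lalgebra_isAlgebra.Build F A tga_scalerAr.
HB.instance Definition _ := Algebra_isFalgebra.Build F A.

Lemma tga_basisM a b : tga_basis a * tga_basis b = xi a b *: tga_basis (a + b).
Proof.
apply/ffunP => g; rewrite tga_mulE (bigD1 a) //= big1 ?addr0.
  rewrite !ffunE eqxx mul1r [a + b]addrC -subr_eq.
  case: eqP => [->|_]; first by rewrite mul1r [RHS]mulr1.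
  by rewrite mul0r scaler0.
by move=> c neq_c; rewrite !ffunE (negPf neq_c) !mul0r.
Qed.

Lemma tga_basis_sum (x : A) : x = \sum_a x a *: tga_basis a.
Proof.
apply/ffunP => g; rewrite sum_ffunE (bigD1 g) //= big1 ?addr0.
  by rewrite !ffunE eqxx [_ *: _]mulr1.
by move=> a neq_a; rewrite !ffunE eq_sym (negPf neq_a) scaler0.
Qed.

End TwistedGroupAlgebra.

Definition lie_commutator (A : nzRingType) (x y : A) : A := x * y - y * x.

(* Lie-theoretic notions for a subspace L of V under a bracket br on V; the
   Lie algebra is (L, br), and only the values of br on L matter. *)
Section LieAlgebra.
Variables (F : fieldType) (V : vectType F) (br : V -> V -> V).
Implicit Types (L I U W : {vspace V}) (x y z : V).

Definition lie_algebra L : Prop :=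
  [/\ forall x y, x \in L -> y \in L -> br x y \in L,
      forall (k : F) x y z, x \in L -> y \in L -> z \in L ->
        br (k *: x + y) z = k *: br x z + br y z,
      forall (k : F) x y z, x \in L -> y \in L -> z \in L ->
        br z (k *: x + y) = k *: br z x + br z y,
      forall x, x \in L -> br x x = 0
    & forall x y z, x \in L -> y \in L -> z \in L ->
        br x (br y z) + br y (br z x) + br z (br x y) = 0].

Definition lie_ideal L I : Prop :=
  (I <= L)%VS /\ forall x y, x \in L -> y \in I -> br x y \in I.

(* By bilinearity the brackets of basis elements span [U, W]. *)
Definition lie_product U W : {vspace V} :=
  <<[seq br x y | x <- vbasis U, y <- vbasis W]>>%VS.

Definition derived_series U (n : nat) : {vspace V} :=
  iter n (fun W => lie_product W W) U.

Definition lie_solvable U : Prop := exists n, derived_series U n = 0%VS.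

(* The radical, i.e. the largest solvable ideal, vanishes. *)
Definition semisimple_lie_algebra L : Prop :=
  lie_algebra L /\
  forall I, lie_ideal L I -> lie_solvable I -> I = 0%VS.

Definition ad_stable x U : Prop := forall y, y \in U -> br x y \in U.

(* ad x is a semisimple endomorphism of L: every invariant subspace has an
   invariant complement. *)
Definition ad_semisimple L x : Prop :=
  forall U, (U <= L)%VS -> ad_stable x U ->
  exists W, [/\ (W <= L)%VS, ad_stable x W,
                (U + W)%VS = L & (U :&: W)%VS = 0%VS].

Variable G : finZmodType.
Implicit Type Gamma : G -> {vspace V}.

Definition lie_grading L Gamma : Prop :=
  [/\ (\sum_g Gamma g)%VS = L,
      directv (\sum_g Gamma g)%VS
    & forall g h x y, x \in Gamma g -> y \in Gamma h ->
        br x y \in Gamma (g + h)].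

Definition multiplicity_free Gamma : Prop :=
  forall g, Gamma g != 0%VS -> \dim (Gamma g) = 1%N.

Definition semisimple_grading L Gamma : Prop :=
  forall g x, x \in Gamma g -> ad_semisimple L x.

End LieAlgebra.

Section SkewRootLieAlgebra.
Variables (F : fieldType) (G : finZmodType) (xi : cocycle2 F G) (R : {set G}).
Local Notation A := (twisted_group_algebra xi).

Definition skew_root_lie_algebra : {vspace A} :=
  (\sum_(a in R) <[tga_basis xi a]>)%VS.

Definition skew_root_component (a : G) : {vspace A} :=
  if a \in R then <[tga_basis xi a]>%VS else 0%VS.

End SkewRootLieAlgebra.

(* Main.v *)
Require Import Defs.
From HB Require Import structures.
From mathcomp Require Import all_boot all_order all_fingroup all_algebra all_field.
From mathcomp Require Import cyclic ring.
Set Implicit Arguments.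
Unset Strict Implicit.
Unset Printing Implicit Defensive.
Import GRing.Theory.
Local Open Scope ring_scope.

(** Write [u_a, u_b] = s(a,b) u_(a+b) with s(a,b) = xi(a,b) - xi(b,a), which is
    xi(b,a) (beta(a,b) - 1) and so vanishes exactly when beta(a,b) = 1.  This
    gives the Lie algebra and the multiplicity free grading at once: the roots
    that occur in a bracket are those that the addition axiom puts in R.

    Semisimplicity is the easy direction of Cartan's criterion.  A last nonzero
    term in the derived series of a solvable ideal is an abelian ideal, so it is
    enough to show that an abelian ideal I is zero [semisimple_of_abelian_ideals].  For y
    in I and w in L the operator ad y ad w squares to zero, hence has trace
    zero.  With w = u_(-a) this trace is computed in the basis (u_b)_(b in R):
    it is y_a times a nonzero constant times the sum over b in R of
    2 - beta(a,b) - beta(a,b)^-1.  As R = -R, the sum is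
    2 (#|R| - sum_b beta(a,b)).  It is nonzero: otherwise #|R| roots of unity
    would add up to #|R|, in characteristic 0 all of them would be 1
    [sum_unity_roots_max], and a would be in the radical of beta since R
    generates G.  So every coordinate y_a vanishes [abelian_ideal_eq0].

    That statement on sums of roots of unity is the triangle inequality in the
    complex numbers.  It passes to an arbitrary field of characteristic 0
    because the cyclotomic polynomials are irreducible over the rationals: an
    integral relation between powers of a primitive n-th root of unity does not
    depend on the field in which the root lives [root_transfer].

    For the semisimple grading, T = ad u_a either kills u_b or moves it through
    nonzero multiples of the u_(b+ia), so that T^n u_b = k u_b with n = #|G| and
    k <> 0.  Since X^n - k has n distinct roots, u_b is a sum of eigenvectors of
    T [cyclic_vector_eigen_decomposition]; so L is spanned by eigenvectors, and
    eigenvectors added one by one give an invariant complement to any invariant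
    subspace [ad_semisimple_of_eigenvectors]. *)

(** * Roots of unity in characteristic 0 *)

Lemma pchar0_intr_eq0 (F : fieldType) (charF : [pchar F] =i pred0) (k : int) :
  (k%:~R == 0 :> F) = (k == 0).
Proof.
have natE := (pcharf0P F).1 charF.
by case: k => n; rewrite ?NegzE ?rmorphN /= ?oppr_eq0 -pmulrn natE.
Qed.

(** X^n - 1 is separable, so it splits with n distinct roots. *)
Lemma closed_prim_root_exists (F : closedFieldType) n :
  n%:R != 0 :> F -> exists z : F, n.-primitive_root z.
Proof.
move=> nz_n; have n_gt0 : (0 < n)%N by case: n nz_n; rewrite ?eqxx.
have [r] := closed_field_poly_normal ('X^n - 1 : {poly F}).
rewrite (monicP (monicXnsubC _ n_gt0)) scale1r => Dr.
have uniq_r : uniq r by rewrite -separable_prod_XsubC -Dr separable_Xn_sub_1.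
have size_r : size r = n.
  by apply: succn_inj; rewrite -(size_prod_XsubC r id) -Dr size_XnsubC.
have root_r : all n.-unity_root r.
  by apply/allP => x; rewrite -root_prod_XsubC -Dr.
have /hasP[z _ prim_z] : has n.-primitive_root r.
  by apply: has_prim_root; rewrite ?size_r.
by exists z.
Qed.

(** Evaluate X^m - 1 as the product of the 'Phi_d for d dividing m.  At m = n
    some 'Phi_d vanishes at z; if d < n, then at m = d this would give z^d = 1. *)
Lemma root_Cyclotomic (F : fieldType) (n : nat) (z : F) :
  n.-primitive_root z -> root (map_poly intr 'Phi_n) z.
Proof.
move=> prim_z; have n_gt0 := prim_order_gt0 prim_z.
have PhiP m : (0 < m)%N -> z ^+ m - 1 =
    \prod_(d <- divisors m) (map_poly intr 'Phi_d).[z].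
  move=> m_gt0; rewrite -horner_prod -rmorph_prod /= prod_Cyclotomic //.
  by rewrite rmorphB rmorph1 /= map_polyXn !hornerE.
have /esym/eqP := PhiP n n_gt0.
rewrite (prim_expr_order prim_z) subrr prodf_seq_eq0 => /hasP[d d_n /= Phi_d0].
have [|ltdn] := eqVneq d n => [<- //|].
have d_gt0 : (0 < d)%N by rewrite -dvdn_divisors // in d_n; exact: dvdn_gt0 d_n.
have /eqP := PhiP d d_gt0; rewrite (big_rem d) /=; last by rewrite -dvdn_divisors.
rewrite (eqP Phi_d0) mul0r subr_eq0 -(prim_order_dvd prim_z) => n_d.
by move: d_n; rewrite -dvdn_divisors // => d_n; rewrite eqn_dvd d_n n_d in ltdn.
Qed.

(** 'Phi_n is the minimal polynomial of w.  If it does not divide f, a Bezout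
    relation over the rationals, cleared of denominators, writes a nonzero
    integer as a combination of 'Phi_n and f; evaluated at z this integer would
    be zero in F. *)
Lemma root_transfer (F : fieldType) (charF : [pchar F] =i pred0) (n : nat)
    (z : F) (w : algC) (f : {poly int}) :
  n.-primitive_root z -> n.-primitive_root w ->
  root (map_poly intr f) z -> root (map_poly intr f) w.
Proof.
move=> prim_z prim_w fz0.
have [p [Dp mon_p dv_p]] := minCpolyP w.
have ZQC (q : {poly int}) :
    map_poly ratr (map_poly intr q : {poly rat}) = map_poly intr q :> {poly algC}.
  by rewrite -map_poly_comp; apply: eq_map_poly => a /=; rewrite rmorph_int.
have Dp_int : p = map_poly intr 'Phi_n.
  apply: (map_poly_inj (ratr : {rmorphism rat -> algC})).
  by rewrite ZQC (Cintr_Cyclotomic prim_w) -Dp (minCpoly_cyclotomic prim_w).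
have pw0 : root (map_poly ratr p) w by rewrite dv_p.
pose fQ : {poly rat} := map_poly intr f.
suffices : p %| fQ by rewrite -dv_p ZQC.
have [co_pf|not_co] := boolP (coprimep p fQ).
  have /Bezout_eq1_coprimepP[[u v] /= uv1] := co_pf.
  (* The integers a and b clear the denominators of u and v. *)
  have [U [a nza Du]] := rat_poly_scale u; have [V [b nzb Dv]] := rat_poly_scale v.
  have : (b *: U) * 'Phi_n + (a *: V) * f = (a * b)%:P.
    apply: (map_inj_poly (intr_inj : injective (intr : int -> rat))) => //.
    rewrite rmorphD !rmorphM /= !map_polyZ !map_polyC /= -Dp_int -/fQ.
    have nza' : a%:~R != 0 :> rat by rewrite intr_eq0.
    have nzb' : b%:~R != 0 :> rat by rewrite intr_eq0.
    have -> : map_poly intr U = a%:~R *: u by rewrite Du scalerA mulfV ?scale1r.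
    have -> : map_poly intr V = b%:~R *: v by rewrite Dv scalerA mulfV ?scale1r.
    rewrite !scalerA -!scalerAl [b%:~R * _]mulrC -scalerDr uv1.
    by rewrite alg_polyC polyCM.
  move/(congr1 (fun q => (map_poly (intr : int -> F) q).[z])).
  rewrite rmorphD !rmorphM /= !map_polyC !hornerE.
  rewrite (rootP (root_Cyclotomic prim_z)) (rootP fz0) !mulr0 addr0 => /esym/eqP.
  by rewrite /= mulf_eq0 !pchar0_intr_eq0 // (negPf nza) (negPf nzb).
have g_p := dvdp_gcdl p fQ; have g_f := dvdp_gcdr p fQ.
apply: dvdp_trans g_f.
(* A proper factor of p cannot vanish at w, as p is minimal. *)
move: pw0; rewrite -[X in map_poly _ X](divpK g_p) rmorphM rootM !dv_p.
case/orP=> [p_h|//].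
have nzp : p != 0 by rewrite monic_neq0.
case/negP: not_co; rewrite /coprimep.
have /andP[nzh nzg] : (p %/ gcdp p fQ != 0) && (gcdp p fQ != 0).
  by rewrite -negb_or -mulf_eq0 divpK.
have := dvdp_leq nzh p_h; rewrite -{1}(divpK g_p) size_mul //.
move: nzh nzg; rewrite -!size_poly_gt0.
case: (size (gcdp p fQ)) => [|[|s]] //.
case: (size (p %/ gcdp p fQ)) => [|k] // _ _.
by rewrite addnS /= -[X in (_ <= X)%N]addn0 leq_add2l.
Qed.

(** Over the complex numbers this is the equality case of the triangle
    inequality.  The hypothesis on the sum is an integral polynomial relation
    for z, which root_transfer moves to a complex root of unity. *)
Lemma sum_unity_roots_max (F : fieldType) (charF : [pchar F] =i pred0) (n : nat)
    (z : F) (I : finType) (P : pred I) (zeta : I -> F) :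
  n.-primitive_root z -> (forall i, P i -> zeta i ^+ n = 1) ->
  \sum_(i | P i) zeta i = #|P|%:R -> forall i, P i -> zeta i = 1.
Proof.
move=> prim_z zeta1 sumz.
have [k Dk] : exists k : I -> nat, forall i, P i -> zeta i = z ^+ k i.
  have ex i : exists j : nat, P i ==> (zeta i == z ^+ j).
    have [Pi|] := boolP (P i); last by exists 0%N.
    by have [j ->] := prim_rootP prim_z (zeta1 i Pi); exists (val j); rewrite eqxx.
  exists (fun i => xchoose (ex i)) => i Pi; apply/eqP.
  exact: (implyP (xchooseP (ex i))).
have [w prim_w] := C_prim_root_exists (prim_order_gt0 prim_z).
pose f : {poly int} := \sum_(i | P i) 'X^(k i) - #|P|%:R%:P.
have evalf (K : fieldType) (x : K) :
    (map_poly intr f).[x] = \sum_(i | P i) x ^+ k i - #|P|%:R.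
  rewrite rmorphB rmorph_sum /= map_polyC hornerD hornerN hornerC /= horner_sum rmorph_nat.
  by congr (_ - _); apply: eq_bigr => i _; rewrite map_polyXn hornerXn.
have /rootP : root (map_poly intr f) w.
  apply: root_transfer prim_z prim_w _ => //; apply/rootP.
  by rewrite evalf -(eq_bigr _ Dk) sumz subrr.
rewrite evalf => /eqP; rewrite subr_eq0 => /eqP sumw.
have normw i : P i -> `|w ^+ k i| = 1.
  move=> _; rewrite Num.Theory.normrX.
  have := congr1 Num.norm (prim_expr_order prim_w).
  rewrite Num.Theory.normrX Num.Theory.normr1 => /eqP.
  rewrite Num.Theory.pexpr_eq1 ?(prim_order_gt0 prim_z) // => /eqP ->.
  exact: expr1n.
move=> i Pi.
have /Num.Theory.normC_sum_upper w1 : forall i, P i -> `|w ^+ k i| <= 1 :> algC.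
  by move=> j Pj; rewrite normw.
have := w1 _ i Pi; rewrite sumw sumr_const => /(_ erefl)/eqP.
rewrite Dk //.
by rewrite -(prim_order_dvd prim_w) (prim_order_dvd prim_z) => /eqP.
Qed.

(** * Trace of an operator of square zero *)

(** In a rank factorisation M = C K, with C injective and K surjective,
    C K C K = 0 forces K C = 0, and tr (C K) = tr (K C). *)
Lemma mxtrace_sqr0 (F : fieldType) m (M : 'M[F]_m) : M *m M = 0 -> \tr M = 0.
Proof.
move=> M2; have := M2; rewrite -{1 2 3}(mulmx_base M).
move: (row_base_free M) (col_base_full M).
move: (col_base M) (row_base M) => C K K_free C_full CKCK.
rewrite mxtrace_mulC (_ : K *m C = 0) ?mxtrace0 //.
apply: (row_free_inj K_free); apply: (row_full_inj C_full).
by rewrite mul0mx mulmx0 -CKCK !mulmxA.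
Qed.

(** The form of mxtrace_sqr0 suited to a basis indexed by a finite type. *)
Lemma sum_diag_sqr0 (F : fieldType) (I : finType) (f : I -> I -> F) :
  (forall i k, \sum_j f i j * f j k = 0) -> \sum_i f i i = 0.
Proof.
move=> f2; pose M := \matrix_(i < #|I|, j < #|I|) f (enum_val i) (enum_val j).
have <- : \tr M = \sum_i f i i.
  by rewrite [RHS](reindex _ (onW_bij _ (enum_val_bij _)));
    apply: eq_bigr => i _; rewrite mxE.
apply: mxtrace_sqr0; apply/matrixP => i k; rewrite !mxE.
rewrite -[RHS](f2 (enum_val i) (enum_val k)).
by rewrite [RHS](reindex _ (onW_bij _ (enum_val_bij _)));
  apply: eq_bigr => j _; rewrite !mxE.
Qed.

(** * Semisimplicity of Lie algebras and of their elements *)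

Lemma span_ind (F : fieldType) (V : vectType F) (X : seq V) (P : V -> Prop) :
    P 0 -> (forall k u v, P u -> P v -> P (k *: u + v)) ->
    (forall v, v \in X -> P v) ->
  forall v, v \in <<X>>%VS -> P v.
Proof.
move=> P0 Plin PX v; rewrite -[X in <<X>>%VS]/(tval (in_tuple X)).
move/coord_span->; elim/big_rec: _ => // i u _ Pu.
by apply: Plin => //; apply/PX/mem_nth.
Qed.

Section LieGeneralities.
Variables (F : fieldType) (V : vectType F) (br : V -> V -> V) (L : {vspace V}).
Hypothesis lieL : lie_algebra br L.

Lemma lie0 y : y \in L -> br 0 y = 0 /\ br y 0 = 0.
Proof.
have [_ linl linr _ _] := lieL; move=> Ly; have L0 := mem0v L.
have := linl (-1) 0 0 y L0 L0 Ly; have := linr (-1) 0 0 y L0 L0 Ly.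
by rewrite scaler0 addr0 !scaleN1r !addNr.
Qed.

Lemma lieC x y : x \in L -> y \in L -> br y x = - br x y.
Proof.
have [_ linl linr alt _] := lieL => Lx Ly.
have Lxy : 1 *: x + y \in L by rewrite scale1r memvD.
have := alt _ Lxy; rewrite linl // !linr // !alt // !scale1r add0r addr0.
by move/eqP; rewrite addrC addr_eq0 => /eqP.
Qed.

Lemma mem_lie_product I x y :
  (I <= L)%VS -> x \in I -> y \in I -> br x y \in lie_product br I I.
Proof.
have [_ linl linr _ _] := lieL => /subvP sIL.
pose P x := x \in L /\ forall y, y \in I -> br x y \in lie_product br I I.
move=> Ix; suff [_ Px] : P x by exact: Px.
move: x Ix; rewrite -{1}(span_basis (vbasisP I)); apply: span_ind => [|k u v|u Bu].
- by split=> [|z /sIL Lz]; rewrite ?mem0v // (lie0 Lz).1 mem0v.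
- case=> Lu Pu [Lv Pv]; split=> [|z Iz]; first by rewrite memvD ?memvZ.
  by rewrite linl ?(sIL z) // memvD ?memvZ ?Pu ?Pv.
have Lu : u \in L by apply/sIL/vbasis_mem.
split=> // z Iz.
suff [] : z \in L /\ br u z \in lie_product br I I by [].
move: z Iz; rewrite -{1}(span_basis (vbasisP I)); apply: span_ind => [|k v w|v Bv].
- by rewrite (lie0 Lu).2 !mem0v.
- case=> Lv Pv [Lw Pw]; split; first by rewrite memvD ?memvZ.
  by rewrite linr // memvD ?memvZ.
split; first by apply/sIL/vbasis_mem.
by apply: memv_span; apply/allpairsP; exists (u, v).
Qed.

(** The Jacobi identity, read as the Leibniz rule for br x. *)
Lemma lie_ideal_derived I :
  lie_ideal br L I -> lie_ideal br L (lie_product br I I).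
Proof.
have [closed linl linr alt jac] := lieL.
case=> sIL' idI; have /subvP sIL := sIL'.
have sub : forall v, v \in lie_product br I I ->
    v \in L /\ forall x, x \in L -> br x v \in lie_product br I I.
  apply: span_ind => [|k u v [Lu Pu] [Lv Pv]|].
  - by split=> [|x /lie0[_ ->]]; rewrite mem0v.
  - split=> [|x Lx]; first by rewrite memvD ?memvZ.
    by rewrite linr // memvD ?memvZ ?Pu ?Pv.
  move=> _ /allpairsP[[p q] /= [/vbasis_mem Ip /vbasis_mem Iq ->]].
  have [Lp Lq] := (sIL _ Ip, sIL _ Iq).
  split=> [|x Lx]; first exact: closed.
  have -> : br x (br p q) = br (br x p) q + br p (br x q).
    have := jac x p q Lx Lp Lq => /eqP.
    rewrite [br q x]lieC // (lieC (closed _ _ Lx Lp) Lq).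
    have := linr (-1) (br x q) 0 p (closed _ _ Lx Lq) (mem0v L) Lp.
    rewrite !addr0 (lie0 Lp).2 addr0 !scaleN1r => ->.
    by rewrite -addrA -opprD subr_eq0 addrC => /eqP.
  by rewrite memvD // mem_lie_product // idI.
split; first by apply/subvP=> v /sub[].
by move=> x y Lx /sub[_]; apply.
Qed.

(** Induction on the derived length: the derived ideal of I has a smaller one,
    so it is zero and I is abelian. *)
Lemma semisimple_of_abelian_ideals :
  (forall I, lie_ideal br L I ->
     (forall x y, x \in I -> y \in I -> br x y = 0) -> I = 0%VS) ->
  semisimple_lie_algebra br L.
Proof.
move=> no_abelian; split=> // I idI [n]; elim: n I idI => [//|n IHn] I idI.
rewrite /derived_series iterSr => /(IHn _ (lie_ideal_derived idI)) I'0.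
apply: no_abelian => // x y Ix Iy; apply/eqP.
by rewrite -memv0 -I'0 mem_lie_product //; case: idI.
Qed.

End LieGeneralities.

Definition ad_eigenvector (F : fieldType) (V : vectType F) (br : V -> V -> V)
  (x v : V) : Prop := exists c : F, br x v = c *: v.

(** Starting from W = 0, run through s and add to W each eigenvector that is not
    yet in U + W: this keeps W invariant and disjoint from U. *)
Lemma ad_semisimple_of_eigenvectors (F : fieldType) (V : vectType F)
    (br : V -> V -> V) (L : {vspace V}) (x : V) (s : seq V) :
  linear (br x) -> (<<s>>)%VS = L ->
  (forall v, v \in s -> ad_eigenvector br x v) -> ad_semisimple br L x.
Proof.
move=> lin span_s eig_s U sUL stU.
suff [W [sWL stW UW0 s_UW]] : exists W, [/\ (W <= L)%VS, ad_stable br x W,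
    (U :&: W)%VS = 0%VS & {subset s <= (U + W)%VS}].
  exists W; split=> //; apply/eqP; rewrite eqEsubv -{2}span_s.
  by apply/andP; split; [rewrite subv_add sUL | apply/span_subvP].
have : {subset s <= L} by move=> v sv; rewrite -span_s memv_span.
elim: {span_s} s eig_s => [|v s IHs] eig_s sL.
  exists 0%VS; split=> //; rewrite ?sub0v ?capv0 // => y.
  rewrite !memv0 => /eqP->; have := lin (-1) 0 0.
  by rewrite scaler0 addr0 scaleN1r addNr => ->.
have [||W [sWL stW UW0 s_UW]] := IHs.
- by move=> u su; apply: eig_s; rewrite inE su orbT.
- by move=> u su; apply: sL; rewrite inE su orbT.
have [UWv|UW'v] := boolP (v \in (U + W)%VS).
  by exists W; split=> // u; rewrite inE => /predU1P[->|/s_UW].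
exists (W + <[v]>)%VS; split.
- by rewrite subv_add sWL; apply: sL; rewrite inE eqxx.
- move=> _ /memv_addP[w Ww [_ /vlineP[k ->] ->]].
  have [|c Dc] := eig_s v; first by rewrite inE eqxx.
  by rewrite addrC lin Dc addrC memv_add ?stW // scalerA memvZ ?memv_line.
- apply/eqP; rewrite -subv0; apply/subvP => y; rewrite memv_cap.
  case/andP=> Uy /memv_addP[w Ww [_ /vlineP[k ->] Dy]].
  have [k0|nzk] := eqVneq k 0.
    rewrite -UW0 memv_cap Uy; move: Dy.
    by rewrite k0 scale0r addr0 => ->.
  case/negP: UW'v; have -> : v = k^-1 *: (y - w).
    by rewrite Dy [w + _]addrC addrK scalerA mulVf ?scale1r.
  by rewrite memvZ // memv_add // memvN.
move=> u; rewrite inE => /predU1P[->|/s_UW]; last first.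
  by apply: subvP; rewrite addvA addvSl.
by rewrite addvA; apply: subvP (addvSr _ _) _ (memv_line v).
Qed.

(** The orbit of u under T / mu has period n, and its discrete Fourier transform
    consists of eigenvectors v_j of T, with eigenvalues z^j mu, whose sum is
    n u.  The second conclusion keeps them inside any T-stable subspace
    containing u. *)
Lemma cyclic_vector_eigen_decomposition (F : fieldType) (V : vectType F)
    (T : {linear V -> V}) (n : nat) (z mu : F) (u : V) :
  n%:R != 0 :> F -> n.-primitive_root z -> mu != 0 ->
  iter n T u = mu ^+ n *: u ->
  exists2 s : seq V, u \in <<s>>%VS &
    forall v, v \in s -> (exists c, T v = c *: v) /\
                         v \in <<[seq iter i T u | i : 'I_n]>>%VS.
Proof.
move=> nzn prim_z nzmu Tn.
have n_gt0 := prim_order_gt0 prim_z.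
have nzz : z != 0.
  apply: contraTneq (oner_neq0 F) => z0; rewrite -(prim_expr_order prim_z) z0.
  by rewrite expr0n gtn_eqF // eqxx.
pose c (j : 'I_n) := z ^+ j * mu.
have nzc j : c j != 0 by rewrite mulf_neq0 ?expf_neq0.
pose v j := \sum_(i < n) (c j)^-1 ^+ i *: iter i T u.
exists [seq v j | j : 'I_n] => [|_ /codomP[j ->]]; last first.
  split; last first.
    by apply: memv_suml => i _; rewrite memvZ // memv_span //; apply: codom_f.
  exists (c j); rewrite /v linear_sum scaler_sumr /=.
  have cn : (c j)^-1 ^+ n *: iter n T u = u.
    rewrite Tn scalerA exprVn exprMn exprAC (prim_expr_order prim_z) expr1n.
    by rewrite mul1r mulVf ?scale1r ?expf_neq0.
  transitivity (\sum_(i < n) c j *: ((c j)^-1 ^+ i.+1 *: iter i.+1 T u)).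
    apply: eq_bigr => i _.
    by rewrite linearZ /= exprS scalerA mulrA mulfV ?mul1r.
  rewrite -!scaler_sumr; congr (_ *: _).
  case: (n) n_gt0 cn => [//|m] _ cn.
  by rewrite big_ord_recr big_ord_recl /= -iterS cn addrC expr0 scale1r.
have -> : u = n%:R^-1 *: \sum_j v j.
  rewrite exchange_big /= (bigD1 (Ordinal n_gt0)) //= [X in _ + X]big1 => [|i nzi].
    under eq_bigr do rewrite expr0 scale1r.
    by rewrite addr0 sumr_const card_ord -scaler_nat scalerA mulVf ?scale1r.
  rewrite -scaler_suml; apply/eqP; rewrite scaler_eq0; apply/orP; left.
  have -> : \sum_(j < n) (c j)^-1 ^+ i = mu^-1 ^+ i * \sum_(j < n) (z^-1 ^+ i) ^+ j.
    rewrite mulr_sumr; apply: eq_bigr => j _.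
    by rewrite /c invfM exprMn mulrC -exprVn [in LHS]exprAC.
  have yn : (z^-1 ^+ i) ^+ n = 1.
    by rewrite exprAC [z^-1 ^+ n]exprVn (prim_expr_order prim_z) invr1 expr1n.
  have := subrX1 (z^-1 ^+ i) n; rewrite {1}yn subrr => /esym/eqP.
  rewrite mulf_eq0 subr_eq0 {1}exprVn invr_eq1 -(prim_order_dvd prim_z).
  rewrite gtnNdvd ?ltn_ord //=; first by move/eqP->; rewrite mulr0.
  by rewrite lt0n; apply: contra nzi => /eqP i0; apply/eqP/val_inj.
by rewrite memvZ // memv_suml // => j _; rewrite memv_span ?codom_f.
Qed.

(** * The commutator bracket *)

Section Commutator.
Variables (F : fieldType) (A : falgType F).
Implicit Types x y z : A.
Local Notation br := (@lie_commutator A).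

Lemma lie_commutator_linear x : linear (br x).
Proof.
move=> k y z; rewrite /lie_commutator mulrDr mulrDl -scalerAr -scalerAl.
by rewrite scalerBr opprD addrACA.
Qed.

HB.instance Definition _ x := GRing.isLinear.Build F A A _ (br x)
  (lie_commutator_linear x).

Lemma lie_commutatorC x y : br y x = - br x y.
Proof. by rewrite /lie_commutator opprB. Qed.

Lemma lie_commutatorZZ (k l : F) x y : br (k *: x) (l *: y) = (k * l) *: br x y.
Proof.
rewrite /lie_commutator -!scalerAl -!scalerAr !scalerA [l * k]mulrC.
by rewrite scalerBr.
Qed.

Lemma lie_commutator_lie_algebra (L : {vspace A}) :
  (forall x y, x \in L -> y \in L -> br x y \in L) -> lie_algebra br L.
Proof.
move=> closed; split=> // [k x y z _ _ _|k x y z _ _ _|x _|x y z _ _ _].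
- by rewrite -[br _ z]opprK -lie_commutatorC linearP opprD -scalerN -!lie_commutatorC.
- exact: linearP.
- exact: subrr.
rewrite /lie_commutator !mulrBr !mulrBl !mulrA.
rewrite !opprD !opprK !addrA.
(* The permutation puts each of the six triple products next to its opposite. *)
rewrite [LHS](ACl (1*11*2*8*3*5*4*10*6*12*7*9)) /=.
by rewrite subrr subrK subrK addrK subrK subrK.
Qed.
End Commutator.

(** * Alternating bicharacters *)

Section BicharacterRoots.
Variables (F : fieldType) (G : finZmodType) (beta : G -> G -> F).
Hypothesis beta_alt : alternating_bicharacter beta.

Lemma bichar0r a : beta a 0 = 1.
Proof.
have [nz _ addr _] := beta_alt; apply: (mulfI (nz a 0)).
by rewrite -addr addr0 mulr1.
Qed.

Lemma bicharNr a b : beta a (- b) = (beta a b)^-1.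
Proof.
have [nz _ addr _] := beta_alt; apply: (mulfI (nz a b)).
by rewrite -addr subrr bichar0r mulfV.
Qed.

Lemma bichar_skew a b : beta b a = (beta a b)^-1.
Proof.
have [nz addl addr alt] := beta_alt; apply: (mulfI (nz a b)); rewrite mulfV //.
have := alt (a + b); rewrite addl !addr !alt mul1r mulr1 => <-.
by [].
Qed.

Lemma bicharNl a b : beta (- a) b = (beta a b)^-1.
Proof. by rewrite bichar_skew bicharNr bichar_skew invrK. Qed.

Lemma bicharMnr a b n : beta a (b *+ n) = beta a b ^+ n.
Proof.
have [_ _ addr _] := beta_alt.
by elim: n => [|n IHn]; rewrite ?bichar0r // mulrS addr IHn exprS.
Qed.

Lemma finZmod_mulrn_card (b : G) : b *+ #|G| = 0.
Proof.
have := expg_cardG (in_setT b); rewrite FinRing.zmodXgE cardsT => ->.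
exact: FinRing.zmod1gE.
Qed.

Lemma bichar_unity_root a b : beta a b ^+ #|G| = 1.
Proof. by rewrite -bicharMnr finZmod_mulrn_card bichar0r. Qed.

(** The kernel of beta a is a subgroup, so it is G as soon as it contains R. *)
Lemma generated_bichar_eq1 (R : {set G}) a :
  <<R>>%g = [set: G] -> (forall b, b \in R -> beta a b = 1) -> a \in Rad beta.
Proof.
have [_ _ addr _] := beta_alt => genR aR1.
pose H := [set b | beta a b == 1].
have gH : group_set H.
  apply/group_setP; split=> [|b c]; rewrite !inE ?FinRing.zmod1gE ?bichar0r //.
  by move=> /eqP b1 /eqP c1; rewrite FinRing.zmodMgE addr b1 c1 mulr1.
have : (<<R>> \subset Group gH)%g.
  by rewrite gen_subG; apply/subsetP => b /aR1 b1; rewrite inE b1.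
rewrite genR => /subsetP sGH; rewrite inE; apply/forallP => b.
by have := sGH b (in_setT b); rewrite inE.
Qed.

End BicharacterRoots.

(** * The Lie algebra of a skew root system *)

Section SkewRootLieAlgebraTheory.
Variables (F : fieldType) (G : finZmodType) (beta : G -> G -> F) (R : {set G}).
Hypotheses (beta_alt : alternating_bicharacter beta)
           (srsR : skew_root_system beta R).
Variable xi : cocycle2 F G.
Hypothesis xi_beta : forall a b, xi a b * (xi b a)^-1 = beta a b.

Local Notation A := (twisted_group_algebra xi).
Local Notation u := (tga_basis xi).
Local Notation L := (skew_root_lie_algebra xi R).
Local Notation Gamma := (skew_root_component xi R).
Local Notation br := (@lie_commutator A).
Implicit Types (x y : A) (a b c g h : G).

Definition structure_constant a b : F := xi a b - xi b a.
Local Notation s := structure_constant.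

Lemma structure_constantE a b : s a b = xi b a * (beta a b - 1).
Proof. by rewrite /s -xi_beta mulrBr mulr1 mulrCA mulfV ?mulr1 ?cocycle_neq0. Qed.

Lemma structure_constant_eq0 a b : (s a b == 0) = (beta a b == 1).
Proof.
by rewrite structure_constantE mulf_eq0 (negPf (cocycle_neq0 xi b a)) subr_eq0.
Qed.

Lemma lie_basis a b : br (u a) (u b) = s a b *: u (a + b).
Proof. by rewrite /lie_commutator !tga_basisM [b + a]addrC -scalerBl. Qed.

Lemma lie_coord x y g :
  br x y g = \sum_a x a * y (g - a) * s a (g - a) :> F.
Proof.
have -> : br x y g = tga_mul x y g - tga_mul y x g :> F by rewrite !ffunE.
rewrite !tga_mulE [X in _ - X](reindex_inj (inv_inj (subKr g))) /= -sumrB.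
apply: eq_bigr => a _; rewrite subKr /s.
by move: (x a : F) (y _ : F) => p q; ring.
Qed.

Lemma lie_basis_coord x b g : br x (u b) g = x (g - b) * s (g - b) b :> F.
Proof.
rewrite lie_coord (bigD1 (g - b)) //= big1 ?addr0 => [|a neq_a].
  by rewrite subKr ffunE eqxx mulr1.
rewrite ffunE subr_eq addrC -subr_eq eq_sym (negPf neq_a).
by rewrite mulr0 mul0r.
Qed.

Lemma mem_skew_root_lie_algebraP x :
  reflect (forall g, g \notin R -> x g = 0) (x \in L).
Proof.
apply: (iffP idP) => [/memv_sumP[v Lv ->] g R'g|x0].
  rewrite sum_ffunE big1 // => a Ra; have /vlineP[k ->] := Lv a Ra.
  by rewrite !ffunE (_ : g == a = false) ?scaler0 //; apply: contraNF R'g => /eqP->.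
rewrite (tga_basis_sum x) (bigID (mem R)) /= [X in _ + X]big1 ?addr0.
  by apply: memv_sumr => a Ra; rewrite memvZ ?memv_line.
by move=> a /x0 ->; rewrite scale0r.
Qed.

Lemma mem_skew_root_componentP x g :
  reflect (x = x g *: u g /\ (g \notin R -> x = 0)) (x \in Gamma g).
Proof.
rewrite /skew_root_component; case: ifP => Rg.
  apply: (iffP (vlineP _ _)) => [[k ->]|[-> _]]; last by exists (x g).
  by split=> //; rewrite !ffunE eqxx /=; congr (_ *: _); rewrite [RHS]mulr1.
rewrite memv0; apply: (iffP eqP) => [->|[_ ->//]].
by rewrite ffunE scale0r.
Qed.

Lemma rootD_of_lie a b : a \in R -> b \in R -> s a b != 0 -> a + b \in R.
Proof.
by have [_ [_ _ _ addR]] := srsR; rewrite structure_constant_eq0; apply: addR.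
Qed.

Lemma skew_root_lie_closed x y : x \in L -> y \in L -> br x y \in L.
Proof.
move=> /mem_skew_root_lie_algebraP x0 /mem_skew_root_lie_algebraP y0.
apply/mem_skew_root_lie_algebraP => g R'g; rewrite lie_coord big1 // => a _.
have [Ra|/x0->] := boolP (a \in R); last by rewrite !mul0r.
have [Rb|/y0->] := boolP (g - a \in R); last by rewrite mulr0 mul0r.
have [->|nzs] := eqVneq (s a (g - a)) 0; first by rewrite mulr0.
by case/negP: R'g; rewrite -(subrK a g) addrC rootD_of_lie.
Qed.

Lemma mem_root_basis a : a \in R -> u a \in L.
Proof.
move=> Ra; apply/mem_skew_root_lie_algebraP => g R'g; rewrite ffunE.
by case: eqP => // Dg; rewrite Dg Ra in R'g.
Qed.

Lemma skew_root_lie_algebra_lie : lie_algebra br L.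
Proof. exact/lie_commutator_lie_algebra/skew_root_lie_closed. Qed.

Lemma skew_root_grading : lie_grading br L Gamma.
Proof.
split.
- by rewrite /skew_root_lie_algebra [RHS]big_mkcond.
- apply/directv_sum_independent => v Gv sum0 i _.
  have [Dv _] := mem_skew_root_componentP _ _ (Gv i isT).
  rewrite Dv; have /ffunP/(_ i) := sum0; rewrite sum_ffunE (bigD1 i) //= big1 ?addr0.
    by rewrite ffunE => ->; rewrite scale0r.
  move=> j neq_j; have [-> _] := mem_skew_root_componentP _ _ (Gv j isT).
  by rewrite !ffunE eq_sym (negPf neq_j) scaler0.
move=> g h x y /mem_skew_root_componentP[Dx x0] /mem_skew_root_componentP[Dy y0].
have [Rg|/x0->] := boolP (g \in R); last by rewrite lie_commutatorC linear0 oppr0 mem0v.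
have [Rh|/y0->] := boolP (h \in R); last by rewrite linear0 mem0v.
rewrite Dx Dy lie_commutatorZZ lie_basis.
have [->|nzs] := eqVneq (s g h) 0; first by rewrite scale0r scaler0 mem0v.
rewrite /skew_root_component rootD_of_lie //.
by rewrite !memvZ ?memv_line.
Qed.

Lemma skew_root_multiplicity_free : multiplicity_free Gamma.
Proof.
move=> g; rewrite /skew_root_component; case: ifP => _; last by rewrite eqxx.
by rewrite -dimv_eq0 dim_vline; case: (u g != 0).
Qed.

(** No factor vanishes along the orbit, because beta(a, b + i a) = beta(a, b). *)
Lemma iter_ad_basis a b n : beta a b != 1 ->
  exists2 k : F, k != 0 & iter n (br (u a)) (u b) = k *: u (b + a *+ n).
Proof.
have [_ _ addr alt] := beta_alt => beta_ab.
elim: n => [|n [k nzk IHn]].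
  by exists 1; rewrite ?oner_eq0 // scale1r mulr0n addr0.
exists (k * s a (b + a *+ n)).
  rewrite mulf_neq0 // structure_constant_eq0 addr.
  by rewrite (bicharMnr beta_alt) alt expr1n mulr1.
by rewrite iterS IHn linearZ /= lie_basis scalerA mulrSr [a + _]addrC addrA.
Qed.

(** Either u_b is killed by ad u_a, or its orbit returns to a nonzero multiple
    of u_b after #|G| steps. *)
Lemma basis_eigen_decomposition (z : F) a b :
    (forall k : F, exists mu, mu ^+ #|G| = k) ->
    #|G|%:R != 0 :> F -> #|G|.-primitive_root z -> a \in R -> b \in R ->
  exists2 t : seq A, u b \in <<t>>%VS &
    forall v, v \in t -> v \in L /\ ad_eigenvector br (u a) v.
Proof.
move=> rootF nzn prim_z Ra Rb; have [beta1|beta_ab] := eqVneq (beta a b) 1.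
  exists [:: u b] => [|v]; first by rewrite memv_span ?inE.
  rewrite inE => /eqP->; split; first exact: mem_root_basis.
  exists 0; rewrite lie_basis scale0r; apply/eqP.
  by rewrite scaler_eq0 structure_constant_eq0 beta1 eqxx.
have [k nzk iter_k] := iter_ad_basis #|G| beta_ab.
rewrite finZmod_mulrn_card addr0 in iter_k.
have [mu Dk] := rootF k.
have nzmu : mu != 0.
  apply: contraNneq nzk => mu0; rewrite -Dk mu0 expr0n.
  by rewrite gtn_eqF ?(prim_order_gt0 prim_z).
rewrite -Dk in iter_k.
have [t t_b t_eig] := cyclic_vector_eigen_decomposition nzn prim_z nzmu iter_k.
exists t => // v /t_eig[eig_v span_v]; split=> //.
move: span_v; apply/subvP; apply/span_subvP => _ /codomP[i ->].
elim: (val i) => [|m IHm]; first exact: mem_root_basis.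
by rewrite iterS skew_root_lie_closed // mem_root_basis.
Qed.

(** For a general homogeneous x = k u_a the eigenvectors are those of ad u_a.
    The hypotheses on F hold in an algebraically closed field of characteristic
    0; they are what the splitting of X^#|G| - k into distinct factors needs. *)
Lemma skew_root_semisimple_grading (z : F) :
    (forall k : F, exists mu, mu ^+ #|G| = k) ->
    #|G|%:R != 0 :> F -> #|G|.-primitive_root z ->
  semisimple_grading br L Gamma.
Proof.
move=> rootF nzn prim_z a x /mem_skew_root_componentP[Dx x0].
have [t tL t_eig] : exists2 t : seq A, (L <= <<t>>)%VS &
    forall v, v \in t -> v \in L /\ ad_eigenvector br x v.
  suff [t tR t_eig] : exists2 t : seq A,
      {subset [seq u b | b <- enum R] <= <<t>>%VS} &
      forall v, v \in t -> v \in L /\ ad_eigenvector br x v.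
    exists t => //; apply/subv_sumP => b Rb; apply: tR.
    by rewrite map_f ?mem_enum.
  have : {subset enum R <= R} by move=> b; rewrite mem_enum.
  elim: (enum R) => [|b r IHr] rR; first by exists [::].
  have [|t tr t_eig] := IHr; first by move=> c rc; apply: rR; rewrite inE rc orbT.
  have Rb : b \in R by apply: rR; rewrite inE eqxx.
  have [t' t'b t'_eig] : exists2 t : seq A, u b \in <<t>>%VS &
      forall v, v \in t -> v \in L /\ ad_eigenvector br x v.
    have [Ra|/x0->] := boolP (a \in R); last first.
      exists [:: u b] => [|v]; first by rewrite memv_span ?inE.
      rewrite inE => /eqP->; split; first exact: mem_root_basis.
      by exists 0; rewrite scale0r lie_commutatorC linear0 oppr0.
    have [t' t'b t'_eig] := basis_eigen_decomposition rootF nzn prim_z Ra Rb.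
    exists t' => // v /t'_eig[Lv [c Dc]]; split=> //; exists (x a * c).
    by rewrite {1}Dx -[v in LHS]scale1r lie_commutatorZZ mulr1 Dc scalerA.
  exists (t' ++ t) => [v|v]; last first.
    by rewrite mem_cat => /orP[/t'_eig|/t_eig].
  rewrite inE span_cat => /predU1P[->|/tr tv].
    exact: subvP (addvSl _ _) _ t'b.
  exact: subvP (addvSr _ _) _ tv.
apply: (@ad_semisimple_of_eigenvectors _ _ _ _ _ t); first exact: linearP.
  apply/eqP; rewrite eqEsubv tL andbT; apply/span_subvP => v.
  by case/t_eig.
by move=> v /t_eig[].
Qed.

(** The eigenvalue of ad u_a ad u_(-a) at u_b, for any a and b: with
    t = beta(a,b), the two brackets contribute the factors t^-1 - 1 and t - 1,
    and the cocycle identity makes the remaining factor independent of b. *)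
Lemma killing_coefficient a b :
  s (- a) b * s a (b - a) =
  xi (- a) a * xi 0 0 * (2 - beta a b - beta a (- b)).
Proof.
have [nz _ addr alt] := beta_alt.
rewrite !structure_constantE mulrACA.
have := cocycleP xi b (- a) a; rewrite addNr cocycle0r => ->.
rewrite (bicharNl beta_alt) addr !(bicharNr beta_alt) alt invr1 mulr1.
have := nz a b; move: (beta a b) => t nzt; congr (_ * _).
by field.
Qed.


(** The operator E = ad y ad u_(-a) maps L to I and I to 0, so its trace over the
    basis (u_b)_(b in R) is zero; by killing_coefficient this trace is y_a times
    a factor that vanishes only if sum_(b in R) beta(a,b) = #|R|, which would put
    the root a in the radical of beta. *)
Lemma abelian_ideal_eq0 (charF : [pchar F] =i pred0) (z : F) (I : {vspace A}) :
    #|G|.-primitive_root z ->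
    lie_ideal br L I -> (forall x y, x \in I -> y \in I -> br x y = 0) ->
  I = 0%VS.
Proof.
move=> prim_z [/subvP sIL idI] abI.
have [nz _ addr alt] := beta_alt; have [_ [sRRad genR oppR _]] := srsR.
apply/eqP; rewrite -subv0; apply/subvP => y Iy; rewrite memv0.
have /mem_skew_root_lie_algebraP y0 := sIL y Iy.
apply/eqP/ffunP => a; rewrite [RHS]ffunE.
have [Ra|/y0 //] := boolP (a \in R).
have mem_brr x w : x \in I -> w \in L -> br x w \in I.
  by move=> Ix Lw; rewrite lie_commutatorC memvN idI.
pose E x := br y (br (u (- a)) x).
have E_I x : x \in L -> E x \in I.
  by move=> Lx; apply/mem_brr/skew_root_lie_closed/Lx/mem_root_basis/oppR.
have E_sqr x : x \in L -> E (E x) = 0.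
  by move=> /E_I IEx; apply/abI/idI/IEx/mem_root_basis/oppR.
(* The matrix of E in the basis (u_b)_(b in R), extended by zero rows to G. *)
pose f b c : F := if b \in R then E (u b) c else 0.
have f2 b d : \sum_c f b c * f c d = 0.
  have [Rb|R'b] := boolP (b \in R); last first.
    by apply: big1 => c _; rewrite /f (negPf R'b) mul0r.
  have := E_sqr _ (mem_root_basis Rb); rewrite {1}[E (u b)]tga_basis_sum /E.
  rewrite 2!linear_sum => /ffunP/(_ d); rewrite sum_ffunE [RHS]ffunE => EE0.
  rewrite -[RHS]EE0.
  apply: eq_bigr => c _; rewrite !linearZ /= ffunE /f Rb.
  have [//|R'c] := boolP (c \in R).
  have /mem_skew_root_lie_algebraP Eub0 := sIL _ (E_I _ (mem_root_basis Rb)).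
  by rewrite -/(E _) Eub0 // mul0r scale0r.
have := sum_diag_sqr0 f2; rewrite -big_mkcond /=.
pose K := xi (- a) a * xi 0 0.
have nzK : K != 0 by rewrite mulf_neq0 ?cocycle_neq0.
have Eb b : E (u b) b = y a * (K * (2 - beta a b - beta a (- b))) :> F.
  rewrite /E lie_basis linearZ /= ffunE lie_basis_coord.
  rewrite opprD opprK addrCA subrr addr0 -killing_coefficient.
  rewrite [- a + b]addrC; move: (y a : F) => p.
  by rewrite -[LHS]/(s (- a) b * (p * s a (b - a))); ring.
under eq_bigr do rewrite Eb.
rewrite -!mulr_sumr => /eqP; rewrite mulf_eq0 [X in _ || X]mulf_eq0 (negPf nzK) /=.
case/orP=> [/eqP//|]; rewrite !sumrB.
have -> : \sum_(b in R) beta a (- b) = \sum_(b in R) beta a b.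
  rewrite [RHS](reindex_inj oppr_inj); apply: eq_bigl => b.
  by apply/idP/idP => /oppR //; rewrite opprK.
rewrite sumr_const -(mulr_natr 2); set S := \sum_(b in R) _.
have -> : 2 * #|R|%:R - S - S = 2 * (#|R|%:R - S) by ring.
rewrite mulf_eq0 ((pcharf0P F).1 charF) /= subr_eq0 => /eqP/esym sumR.
have betaR1 := sum_unity_roots_max charF prim_z
  (fun b _ => bichar_unity_root beta_alt a b) sumR.
have := subsetP sRRad a Ra; rewrite inE => /andP[/negP[]].
exact: generated_bichar_eq1 genR betaR1.
Qed.

End SkewRootLieAlgebraTheory.

Theorem proposition4p14 (F : closedFieldType) (charF : [pchar F] =i pred0)
    (G : finZmodType) (beta : G -> G -> F) (R : {set G})
    (beta_alt : alternating_bicharacter beta)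
    (srsR : skew_root_system beta R)
    (xi : cocycle2 F G)
    (xi_beta : forall a b, xi a b * (xi b a)^-1 = beta a b) :
  let br := @lie_commutator (twisted_group_algebra xi) in
  let L := skew_root_lie_algebra xi R in
  let Gamma := skew_root_component xi R in
  [/\ semisimple_lie_algebra br L,
      lie_grading br L Gamma,
      multiplicity_free Gamma
    & semisimple_grading br L Gamma].
Proof.
move=> br L Gamma.
have nzn : #|G|%:R != 0 :> F.
  by rewrite ((pcharf0P F).1 charF) -lt0n; apply/card_gt0P; exists 0.
have [z prim_z] := closed_prim_root_exists nzn.
split.
- apply: semisimple_of_abelian_ideals (skew_root_lie_algebra_lie srsR xi_beta) _.
  by move=> I; exact: (abelian_ideal_eq0 beta_alt srsR xi_beta charF prim_z).
- exact: (skew_root_grading srsR xi_beta).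
- exact: skew_root_multiplicity_free.
apply: (skew_root_semisimple_grading _ srsR xi_beta _ nzn prim_z) => // k.
have /closed_rootP[mu] : size ('X^#|G| - k%:P) != 1%N.
  rewrite size_XnsubC ?(prim_order_gt0 prim_z) //.
  by rewrite eqSS -lt0n (prim_order_gt0 prim_z).
by rewrite /root !hornerE subr_eq0 => /eqP; exists mu.
Qed.
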